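(* Let $\mathcal{K}$ be a countable Turing ideal, and let $\mathbb{B}$ be the Boolean algebra of all sets $A\subseteq\omega$ whose Turing degree is in $\mathcal{K}$. Then for every $\mathbb{B}$-ultrafilter base $F$ and every function $p\colon\omega\to\omega$ associated with $F$, the function $p$ is not dominated by any function whose Turing degree is in $\mathcal{K}$.
   Context: ''Set'' means subset of $\omega$. For sets $A,B$, $A\subseteq^* B$ means $A\setminus B$ is finite. With $\langle\cdot,\cdot\rangle$ the usual computable Cantor pairing function on $\omega$, a set $X\subseteq\omega$ encodes the sequence $(X_n)_{n\in\omega}$ of its columns $X_n=\{u:\langle u,n\rangle\in X\}$, and $X$ is identified with this sequence. Let $\mathbb{B}$ be a countable Boolean algebra of subsets of $\omega$ closed under finite differences. A $\mathbb{B}$-tower is a set $G$ such that $G_n\in\mathbb{B}$ for all $n$, $G_0=\omega$, and for each $n$, $G_{n+1}\subseteq^* G_n$ and $G_n\setminus G_{n+1}$ is infinite. A $\mathbb{B}$-ultrafilter base is a $\mathbb{B}$-tower $F$ such that for each $R\in\mathbb{B}$ there is $n$ with $F_n\subseteq^* R$ or $F_n\subseteq^*\overline{R}$ (where $\overline{R}=\omega\setminus R$). A function $p\colon\omega\to\omega$ is associated with a tower $G$ if $p$ is strictly increasing and $p(n)\in\bigcap_{i\le n}G_i$ for each $n$. For $f,g\colon\omega\to\omega$, $g$ dominates $f$ if $g(n)\ge f(n)$ for all sufficiently large $n$. A Turing ideal is a nonempty class of Turing degrees closed downward and under joins. *)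

(* Defs.v *)
From Stdlib Require Import Cantor.
From mathcomp Require Import all_boot.
From mathcomp Require Import boolp classical_sets functions cardinality.

Set Implicit Arguments.
Unset Strict Implicit.
Unset Printing Implicit Defensive.

Local Open Scope nat_scope.
Local Open Scope classical_set_scope.

(* Turing reducibility is relative mu-recursiveness (Kleene): [prog n] is the
   syntax of n-ary partial functions recursive in an oracle, and
   [computes O e v y] says that e, with oracle O, converges on v with value y. *)
Inductive prog : nat -> Type :=
| PZero : prog 0
| PSucc : prog 1
| PProj n (i : 'I_n) : prog n
| POracle : prog 1
| PComp m n (f : prog m) (g : 'I_m -> prog n) : prog n
| PRec n (f : prog n) (g : prog n.+2) : prog n.+1
| PMin n (f : prog n.+1) : prog n.

(* In [PRec] the recursion variable is the first argument and the sequence s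
   lists the successive values. In [PMin] the function must converge to a
   nonzero value at every point below the minimum. *)
Fixpoint computes (O : set nat) n (e : prog n) : n.-tuple nat -> nat -> Prop :=
  match e in prog n return n.-tuple nat -> nat -> Prop with
  | PZero => fun _ y => y = 0
  | PSucc => fun v y => y = (thead v).+1
  | PProj _ i => fun v y => y = tnth v i
  | POracle => fun v y => y = `[< O (thead v) >]
  | PComp m _ f g => fun v y =>
      exists2 w : m.-tuple nat,
        forall i, computes O (g i) v (tnth w i) & computes O f w y
  | PRec _ f g => fun v y =>
      let x := thead v in
      let v' := [tuple of behead v] in
      exists s : nat -> nat,
        [/\ computes O f v' (s 0),
            forall i, i < x -> computes O g [tuple of i :: s i :: v'] (s i.+1)
          & y = s x]
  | PMin _ f => fun v y =>
      computes O f [tuple of y :: v] 0 /\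
      forall z, z < y -> exists k, computes O f [tuple of z :: v] k.+1
  end.

Definition turing_le (A B : set nat) : Prop :=
  exists e : prog 1, forall x, computes B e [tuple x] `[< A x >].

Definition turing_equiv (A B : set nat) : Prop :=
  turing_le A B /\ turing_le B A.

Definition turing_degree : Type :=
  {D : set (set nat) | exists A, D = [set B | turing_equiv B A]}.

Definition degree (A : set nat) : turing_degree :=
  exist _ [set B | turing_equiv B A] (ex_intro _ A erefl).

Definition pairing (u n : nat) : nat := Cantor.to_nat (u, n).

Definition graph (f : nat -> nat) : set nat := range (fun n => pairing n (f n)).

Definition fun_degree (f : nat -> nat) : turing_degree := degree (graph f).

Definition join (A B : set nat) : set nat :=
  [set x.*2 | x in A] `|` [set x.*2.+1 | x in B].

Definition turing_ideal (K : set turing_degree) : Prop :=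
  [/\ K !=set0,
      forall A B, turing_le A B -> K (degree B) -> K (degree A)
    & forall A B, K (degree A) -> K (degree B) -> K (degree (join A B))].

Definition sets_of_ideal (K : set turing_degree) : set (set nat) :=
  [set A | K (degree A)].

Definition almost_subset (A B : set nat) : Prop := finite_set (A `\` B).

Definition column (X : set nat) (n : nat) : set nat :=
  [set u | X (pairing u n)].

Definition is_tower (B : set (set nat)) (G : set nat) : Prop :=
  [/\ forall n, B (column G n),
      column G 0 = [set: nat]
    & forall n, almost_subset (column G n.+1) (column G n) /\
                infinite_set (column G n `\` column G n.+1)].

Definition is_ultrafilter_base (B : set (set nat)) (F : set nat) : Prop :=
  is_tower B F /\
  forall R, B R -> exists n,
    almost_subset (column F n) R \/ almost_subset (column F n) (~` R).

Definition associated (p : nat -> nat) (G : set nat) : Prop :=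
  {homo p : m n / m < n} /\
  forall n, (\bigcap_(i in [set i | i <= n]) column G i) (p n).

Definition dominates (g f : nat -> nat) : Prop :=
  exists N, forall n, N <= n -> f n <= g n.

(* Main.v *)
Require Import Defs.
From Stdlib Require Import Cantor.
From mathcomp Require Import all_boot.
From mathcomp Require Import boolp classical_sets functions cardinality.

(** Suppose that [f], of degree in the ideal, dominates [p]. As [p] is strictly
    increasing, [p a] lies in the interval [[a, f a]] for all large [a]. Cut the
    natural numbers into consecutive blocks, the block starting at [a] being
    long enough to contain [[a, f a]], and let [R] be the union of every second
    block. Then [R] is computable from [f], so it belongs to the Boolean
    algebra and some column [F_n] of the base is almost contained in [R] or in
    its complement. But for every block start [a] that is large enough, [p a]
    is an element of [F_n] inside the block of [a]; hence [F_n] has infinitely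
    many elements in [R] and infinitely many outside.

    To keep the computation of [R] simple, the block starting at [a] ends just
    before [a + 2 f a + 1]. Successive block starts then have opposite parities,
    so the block structure is carried by one number-valued function,
    [next_start f x], the first block start above [x], and [R] is the set of
    the [x] at which this function is odd. The combinatorial content is
    [exists_block_of_parity] and [not_almost_subset_of_gaps]; the rest shows
    that [next_start f] is recursive in the graph of [f]
    ([computable_next_start]). *)

Local Open Scope nat_scope.
Local Open Scope classical_set_scope.

(** * Relative recursiveness of total functions *)

Definition computable (O : set nat) n (F : n.-tuple nat -> nat) : Prop :=
  exists e : prog n, forall v, computes O e v (F v).

Arguments computable O {n} F.

Section Computable.
Variable O : set nat.

Lemma computable_ext n (F G : n.-tuple nat -> nat) :
  F =1 G -> computable O F -> computable O G.
Proof. by move=> FG [e he]; exists e => v; rewrite -FG. Qed.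

(** Arguments are read with [nth] rather than [tnth], so that they simplify
    on explicit tuples. *)
Lemma computable_arg n i :
  i < n -> computable O (fun v : n.-tuple nat => nth 0 v i).
Proof.
by move=> lt_in; exists (PProj (Ordinal lt_in)) => v /=; rewrite (tnth_nth 0).
Qed.

Lemma computable_comp m n (F : m.-tuple nat -> nat)
    (G : 'I_m -> n.-tuple nat -> nat) :
  computable O F -> (forall i, computable O (G i)) ->
  computable O (fun v => F [tuple G i v | i < m]).
Proof.
move=> [f hf] /choice[g hg]; exists (PComp f g) => v /=.
exists [tuple G i v | i < m]; last exact: hf.
by move=> i; rewrite tnth_mktuple.
Qed.

Lemma computable_comp1 n (h : nat -> nat) (F : n.-tuple nat -> nat) :
  computable O (fun w : 1.-tuple nat => h (nth 0 w 0)) -> computable O F ->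
  computable O (fun v => h (F v)).
Proof.
move=> ch cF.
apply: computable_ext (computable_comp _ _ _ (fun=> F) ch (fun=> cF)) => v.
by rewrite -(tnth_nth 0 _ ord0) tnth_mktuple.
Qed.

Lemma computable_comp2 n (h : nat -> nat -> nat) (F G : n.-tuple nat -> nat) :
  computable O (fun w : 2.-tuple nat => h (nth 0 w 0) (nth 0 w 1)) ->
  computable O F -> computable O G -> computable O (fun v => h (F v) (G v)).
Proof.
move=> ch cF cG.
pose FG (i : 'I_2) := if i == ord0 then F else G.
have cFG i : computable O (FG i) by rewrite /FG; case: ifP.
apply: computable_ext (computable_comp _ _ _ FG ch cFG) => v.
by rewrite -(tnth_nth 0 _ ord0) -(tnth_nth 0 _ ord_max) !tnth_mktuple.
Qed.

(** The recursion equations are hypotheses on [H], so that a function already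
    defined on [nat] is shown recursive without being rewritten as a recursor. *)
Lemma computable_rec n (H : n.+1.-tuple nat -> nat) (F : n.-tuple nat -> nat)
    (G : n.+2.-tuple nat -> nat) :
  computable O F -> computable O G ->
  (forall t : n.-tuple nat, H [tuple of 0 :: t] = F t) ->
  (forall x (t : n.-tuple nat),
     H [tuple of x.+1 :: t] = G [tuple of x :: H [tuple of x :: t] :: t]) ->
  computable O H.
Proof.
move=> [f hf] [g hg] H0 HS; exists (PRec f g) => v.
pose t : n.-tuple nat := [tuple of behead v].
exists (fun i => H [tuple of i :: t]); split => [|i _|].
- by rewrite H0; exact: hf.
- by rewrite HS; exact: hg.
- by rewrite [in LHS](tuple_eta v); congr H; exact: val_inj.
Qed.

Lemma computable_min n (F : n.+1.-tuple nat -> nat) (M : n.-tuple nat -> nat) :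
  computable O F ->
  (forall v, F [tuple of M v :: v] = 0) ->
  (forall v z, z < M v -> 0 < F [tuple of z :: v]) ->
  computable O M.
Proof.
move=> [f hf] FM0 Flt; exists (PMin f) => v /=; split.
  by rewrite -(FM0 v); exact: hf.
move=> z /Flt F_gt0; exists (F [tuple of z :: v]).-1.
by rewrite prednK //; exact: hf.
Qed.

Lemma computable_oracle n (F : n.-tuple nat -> nat) :
  computable O F -> computable O (fun v => `[< O (F v) >] : nat).
Proof.
apply: (computable_comp1 _ (fun x => `[< O x >] : nat)).
by exists POracle => v /=; case/tupleP: v => x t; rewrite theadE.
Qed.

Lemma computable_succ n (F : n.-tuple nat -> nat) :
  computable O F -> computable O (fun v => (F v).+1).
Proof.
apply: (computable_comp1 _ succn).
by exists PSucc => v /=; case/tupleP: v => x t; rewrite theadE.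
Qed.

Lemma computable_const n c : computable O (fun _ : n.-tuple nat => c).
Proof.
elim: c => [|c]; last exact: computable_succ.
have c0 : computable O (fun _ : 0.-tuple nat => 0) by exists PZero.
by apply: (computable_comp _ _ _ (fun i _ => 0) c0); case.
Qed.

(** * Some recursive functions *)

Lemma computable_add n (F G : n.-tuple nat -> nat) :
  computable O F -> computable O G -> computable O (fun v => F v + G v).
Proof.
apply: (computable_comp2 _ addn).
apply: (computable_rec _ _ (fun t => nth 0 t 0)
  (fun w => (nth 0 w 1).+1)) => //.
- exact: computable_arg.
- by apply/computable_succ/computable_arg.
Qed.

Lemma computable_pred n (F : n.-tuple nat -> nat) :
  computable O F -> computable O (fun v => (F v).-1).
Proof.
apply: (computable_comp1 _ predn).
apply: (computable_rec _ _ (fun=> 0) (fun w => nth 0 w 0)) => //.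
- exact: computable_const.
- exact: computable_arg.
Qed.

Lemma computable_sub n (F G : n.-tuple nat -> nat) :
  computable O F -> computable O G -> computable O (fun v => F v - G v).
Proof.
move=> cF cG; apply: (computable_comp2 _ (fun x y => y - x)) => //.
apply: (computable_rec _ _ (fun t => nth 0 t 0) (fun w => (nth 0 w 1).-1)).
- exact: computable_arg.
- by apply/computable_pred/computable_arg.
- by move=> t /=; rewrite subn0.
- by move=> x t /=; rewrite subnS.
Qed.

Lemma computable_odd n (F : n.-tuple nat -> nat) :
  computable O F -> computable O (fun v => odd (F v) : nat).
Proof.
apply: (computable_comp1 _ (fun x => odd x : nat)).
apply: (computable_rec _ _ (fun=> 0) (fun w => 1 - nth 0 w 1)) => //.
- exact: computable_const.
- by apply: computable_sub; [exact: computable_const | exact: computable_arg].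
- by move=> x t /=; case: (odd x).
Qed.

Lemma computable_if_leq n (F G H L : n.-tuple nat -> nat) :
  computable O F -> computable O G -> computable O H -> computable O L ->
  computable O (fun v => if F v <= G v then H v else L v).
Proof.
move=> cF cG cH cL.
(* [select] branches on whether its first argument, here the truncated
   difference [F v - G v], vanishes. *)
pose select (w : 3.-tuple nat) :=
  if nth 0 w 0 == 0 then nth 0 w 1 else nth 0 w 2.
have c_select : computable O select.
  apply: (computable_rec _ _ (fun t => nth 0 t 0) (fun w => nth 0 w 3)) => //.
  - exact: computable_arg.
  - exact: computable_arg.
pose args := [tuple (fun v => F v - G v); H; L].
have c_args i : computable O (tnth args i).
  by case: i => [[|[|[|]]]] // ?; rewrite (tnth_nth L) //=;
    exact: computable_sub.
apply: computable_ext (computable_comp _ _ _ _ c_select c_args) => v.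
rewrite /select -(tnth_nth 0 _ (@Ordinal 3 0 isT)).
rewrite -(tnth_nth 0 _ (@Ordinal 3 1 isT)) -(tnth_nth 0 _ (@Ordinal 3 2 isT)).
by rewrite !tnth_mktuple.
Qed.

Lemma computable_pairing n (F G : n.-tuple nat -> nat) :
  computable O F -> computable O G ->
  computable O (fun v => pairing (F v) (G v)).
Proof.
pose triangle := nat_rec (fun=> nat) 0 (fun i m => i.+1 + m).
have c_triangle :
    computable O (fun w : 1.-tuple nat => triangle (nth 0 w 0)).
  apply: (computable_rec _ _ (fun=> 0)
    (fun w => (nth 0 w 0).+1 + nth 0 w 1)) => //.
  - exact: computable_const.
  - apply: computable_add; last exact: computable_arg.
    exact/computable_succ/computable_arg.
move=> cF cG.
have c_sum := computable_comp1 _ triangle _ c_triangle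
  (computable_add _ _ _ cG cF).
exact: computable_ext (computable_add _ _ _ cG c_sum).
Qed.

End Computable.

Lemma computable_turing_le O (A : set nat) :
  computable O (fun v : 1.-tuple nat => `[< A (nth 0 v 0) >] : nat) ->
  turing_le A O.
Proof. by move=> [e he]; exists e => x; exact: (he [tuple x]). Qed.

(** [f x] is found by searching for the [y] such that the pair of [x] and [y]
    is in the graph. *)
Lemma computable_graph f n (F : n.-tuple nat -> nat) :
  computable (graph f) F -> computable (graph f) (fun v => f (F v)).
Proof.
have graphE x y : `[< graph f (pairing x y) >] = (y == f x).
  apply/asboolP/eqP => [[z _ /(congr1 Cantor.of_nat)]|->]; last by exists x.
  by rewrite !cancel_of_to => -[<- <-].
apply: computable_comp1.
apply: (computable_min _ _
  (fun w => 1 - `[< graph f (pairing (nth 0 w 1) (nth 0 w 0)) >])).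
- apply: computable_sub; first exact: computable_const.
  by apply/computable_oracle/computable_pairing; exact: computable_arg.
- by move=> v /=; rewrite graphE eqxx.
- by move=> v z lt_z /=; rewrite graphE ltn_eqF.
Qed.

(** * Blocks of alternating parity *)

(** Besides [0], the block starts are the [x.+1] at which the first branch is
    taken, that is, where [next_start f x] has just been reached: by
    [next_start_gt], the test [next_start f x <= x.+1] is then an equality. *)
Fixpoint next_start (f : nat -> nat) (x : nat) : nat :=
  if x is x'.+1 then
    if next_start f x' <= x then x + (f x).*2.+1 else next_start f x'
  else (f 0).*2.+1.

Lemma computable_next_start f :
  computable (graph f) (fun v : 1.-tuple nat => next_start f (nth 0 v 0)).
Proof.
apply: (computable_rec _ _ _ (fun=> (f 0).*2.+1)
  (fun w => if nth 0 w 1 <= (nth 0 w 0).+1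
            then (nth 0 w 0).+1 + (f (nth 0 w 0).+1).*2.+1
            else nth 0 w 1)) => //; first exact: computable_const.
have c_succ : computable (graph f) (fun w : 2.-tuple nat => (nth 0 w 0).+1).
  exact/computable_succ/computable_arg.
have c_f := computable_graph _ _ _ c_succ.
apply: computable_if_leq => //; try exact: computable_arg.
apply: computable_add => //; apply: computable_succ.
by apply: computable_ext (computable_add _ _ _ _ c_f c_f) => v; rewrite addnn.
Qed.

Lemma next_start_gt f x : x < next_start f x.
Proof.
elim: x => //= x IH; case: ifPn => [_|]; last by rewrite -ltnNge.
by rewrite addnS ltnS leq_addr.
Qed.

Lemma next_start_const f x y :
  x <= y -> y < next_start f x -> next_start f y = next_start f x.
Proof.
elim: y => [|y IH]; first by rewrite leqn0 => /eqP->.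
rewrite leq_eqVlt => /predU1P[->//|]; rewrite ltnS => le_xy lt_y.
by rewrite /= IH ?(ltnW lt_y) // leqNgt lt_y.
Qed.

Lemma next_start_start f x (a := next_start f x) :
  next_start f a = a + (f a).*2.+1.
Proof.
have lt_xa : x < a := next_start_gt f x.
case Ea: a lt_xa => [//|b] /=; rewrite ltnS => le_xb.
by rewrite (next_start_const f x b) -/a ?Ea ?leqnn.
Qed.

(** On the block starting at [a], [next_start f] has the parity opposite to
    that of [a], and of two successive block starts beyond [M] one is even and
    the other odd. *)
Lemma exists_block_of_parity f (b : bool) M :
  exists2 a, M <= a &
    forall y, a <= y <= f a -> odd (next_start f y) = b.
Proof.
have block x (a := next_start f x) y :
    a <= y <= f a -> odd (next_start f y) = ~~ odd a.
  move=> /andP[le_ay le_yf].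
  have Ea := next_start_start f x; rewrite -/a in Ea.
  rewrite (next_start_const f a) // Ea.
    by rewrite oddD /= odd_double addbT.
  rewrite addnS ltnS (leq_trans le_yf) // -addnn addnA.
  by rewrite leq_addl.
set a := next_start f M; have ltMa : M < a := next_start_gt f M.
have [oa|oa] := boolP (odd a == ~~ b).
  by exists a; [exact: ltnW | move=> y /block->; rewrite (eqP oa) negbK].
exists (next_start f a).
  exact: ltnW (ltn_trans ltMa (next_start_gt f a)).
move=> y /block->; rewrite next_start_start oddD /= odd_double addbT negbK.
by move: oa; case: (odd _); case: (b).
Qed.

(** * Domination and almost inclusion *)

Lemma homo_ltn_leq_id (p : nat -> nat) n :
  {homo p : i j / i < j} -> n <= p n.
Proof.
by move=> p_mono; elim: n => // n IH; exact: leq_ltn_trans IH (p_mono _ _ _).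
Qed.

Lemma finite_set_nat_bounded (A : set nat) :
  finite_set A -> exists M, forall x, A x -> x <= M.
Proof.
move=> /finite_seqP[s ->]; exists (\max_(x <- s) x) => x /= xs.
exact: leq_bigmax_seq.
Qed.

(** If [f] dominates [p], every late gap [[a, f a]] of [S] contains the point
    [p a] of the column. *)
Lemma not_almost_subset_of_gaps (F : set nat) (p f : nat -> nat)
    (S : set nat) n :
  associated p F -> dominates f p ->
  (forall M, exists2 a, M <= a & forall y, a <= y <= f a -> ~ S y) ->
  ~ almost_subset (column F n) S.
Proof.
move=> [p_mono pF] [N pf] gaps /finite_set_nat_bounded[M leM].
have [a le_a gap] := gaps (N + n + M.+1).
have leNa : N <= a by rewrite (leq_trans _ le_a) // -addnA leq_addr.
have lena : n <= a.
  by rewrite (leq_trans _ le_a) // addnAC leq_addl.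
have ltMa : M < a by rewrite (leq_trans _ le_a) // leq_addl.
have le_ap : a <= p a by exact: homo_ltn_leq_id.
have /leM : (column F n `\` S) (p a).
  by split; [exact: pF | apply: gap; rewrite le_ap pf].
by rewrite leqNgt (leq_trans ltMa le_ap).
Qed.

Theorem proposition1p6 (K : set turing_degree) (hK : turing_ideal K)
    (hKc : countable K) (F : set nat)
    (hF : is_ultrafilter_base (sets_of_ideal K) F)
    (p : nat -> nat) (hp : associated p F) (f : nat -> nat)
    (hf : K (fun_degree f)) :
  ~ dominates f p.
Proof.
move=> dom_fp.
pose R : set nat := [set x | odd (next_start f x)].
have KR : sets_of_ideal K R.
  case: hK => _ K_down _; apply: (K_down _ (graph f)) => //.
  apply: computable_turing_le.
  apply: computable_ext (computable_odd _ _ _ (computable_next_start f)) => v.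
  by rewrite /R /= asboolb.
case: hF => _ /(_ R KR)[n].
case; apply: not_almost_subset_of_gaps hp dom_fp _ => M.
- have [a leMa blk] := exists_block_of_parity f false M.
  by exists a => // y /blk; rewrite /R /= => ->.
- have [a leMa blk] := exists_block_of_parity f true M.
  by exists a => // y /blk oy; apply; rewrite /R /= oy.
Qed.
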